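(* Let $1\le M<N$ and $\epsilon>0$, and let $F(\delta,K,N)$ denote the optimal Parseval Paulsen function. Then \[F(\epsilon,M,N)\le 8\,F\Big(\epsilon\frac{M}{N-M},\,N-M,\,N\Big).\]
   Context: $\mathcal H_K$ denotes a $K$-dimensional Hilbert space. A family $\{f_i\}_{i=1}^N$ in $\mathcal H_K$ is a Parseval frame if $\sum_{i=1}^N|\langle f,f_i\rangle|^2=\|f\|^2$ for all $f\in\mathcal H_K$; it is equal norm if all $\|f_i\|$ are equal; it is $\delta$-nearly equal norm if $(1-\delta)\frac KN\le\|f_i\|^2\le(1+\delta)\frac KN$ for all $i$. For $\mathcal F=\{f_i\}_{i=1}^N$, $\mathcal G=\{g_i\}_{i=1}^N$, $d(\mathcal F,\mathcal G)=\sum_{i=1}^N\|f_i-g_i\|^2$. The optimal Parseval Paulsen function $F(\delta,K,N)$ is the supremum, over all $\delta$-nearly equal norm Parseval frames $\mathcal F$ of $N$ vectors for $\mathcal H_K$, of $\inf\{d(\mathcal F,\mathcal G):\mathcal G\text{ an equal norm Parseval frame of }N\text{ vectors for }\mathcal H_K\}$. *)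

(* Defs.v *)
From Stdlib Require Import Reals Lra ClassicalEpsilon.
Open Scope R_scope.

Fixpoint sumR (n : nat) (f : nat -> R) : R :=
  match n with O => 0 | S m => sumR m f + f m end.

(* A vector of C^K is a function from coordinate indices to (re, im);
   only coordinates j < K are meaningful (others must be zero). *)
Definition cvec := nat -> (R * R).

(* The field: cplx = true gives C^K, cplx = false gives R^K
   (imaginary parts forced to 0). *)
Definition in_space (cplx : bool) (K : nat) (f : cvec) : Prop :=
  forall j, ((K <= j)%nat -> f j = (0, 0)) /\ (cplx = false -> snd (f j) = 0).

(* <f,g> = sum_j f_j * conj(g_j) *)
Definition inner_re (K : nat) (f g : cvec) : R :=
  sumR K (fun j => fst (f j) * fst (g j) + snd (f j) * snd (g j)).
Definition inner_im (K : nat) (f g : cvec) : R :=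
  sumR K (fun j => snd (f j) * fst (g j) - fst (f j) * snd (g j)).
Definition inner_abs2 (K : nat) (f g : cvec) : R :=
  inner_re K f g ^ 2 + inner_im K f g ^ 2.
Definition norm2 (K : nat) (f : cvec) : R :=
  sumR K (fun j => fst (f j) ^ 2 + snd (f j) ^ 2).

Definition vsub (f g : cvec) : cvec :=
  fun j => (fst (f j) - fst (g j), snd (f j) - snd (g j)).

(* A family {f_i}_{i<N}; indices >= N are ignored. *)
Definition family := nat -> cvec.

Definition family_in (cplx : bool) (K N : nat) (F : family) : Prop :=
  forall i, (i < N)%nat -> in_space cplx K (F i).

Definition parseval (cplx : bool) (K N : nat) (F : family) : Prop :=
  forall f, in_space cplx K f ->
    sumR N (fun i => inner_abs2 K f (F i)) = norm2 K f.

Definition equal_norm (K N : nat) (F : family) : Prop :=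
  forall i j, (i < N)%nat -> (j < N)%nat -> norm2 K (F i) = norm2 K (F j).

Definition nearly_equal_norm (delta : R) (K N : nat) (F : family) : Prop :=
  forall i, (i < N)%nat ->
    (1 - delta) * (INR K / INR N) <= norm2 K (F i) <= (1 + delta) * (INR K / INR N).

Definition frame_dist (K N : nat) (F G : family) : R :=
  sumR N (fun i => norm2 K (vsub (F i) (G i))).

(* Supremum / infimum of a set of reals (least upper bound, chosen by
   classical epsilon; all sets used below are nonempty and bounded). *)
Definition supR (S : R -> Prop) : R :=
  epsilon (inhabits 0) (fun x => is_lub S x).
Definition infR (S : R -> Prop) : R := - supR (fun x => S (- x)).

Definition dist_to_ENP (cplx : bool) (K N : nat) (F : family) : R :=
  infR (fun d => exists G, family_in cplx K N G /\ equal_norm K N G /\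
                          parseval cplx K N G /\ d = frame_dist K N F G).

Definition paulsen (cplx : bool) (delta : R) (K N : nat) : R :=
  supR (fun x => exists F, family_in cplx K N F /\
                          nearly_equal_norm delta K N F /\
                          parseval cplx K N F /\ x = dist_to_ENP cplx K N F).

(* Main.v *)
(** A frame is identified with the [N * K] matrix [T] whose rows are its vectors:
    it is Parseval iff [T* T = 1], its squared norms are the diagonal of [T T*],
    and the distance of frames is the squared Hilbert-Schmidt norm [hs2].  If
    [T T* + S S* = 1], the rows of [S] form the Naimark complement, whose squared
    norms are [1] minus those of [T]; so equal norm and near equality of norms
    pass to the complement.

    Let [S'] be an equal norm Parseval frame near [S] and [T0] a complement of
    [S'].  The complements of [S'] are the [T0 V] with [V] unitary, and
    [hs2 (T - T0 V) = 2 K - 2 Re tr (V* H)] with [H = T0* T].  For [V] the unitary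
    part of the polar decomposition of [H], [V* H = (H* H)^(1/2)], whose trace is
    at least that of [H* H] because [H] is a contraction.  This bounds the distance
    by [2 (K - tr (H* H)) = 2 hs2 (S'* T) <= 2 hs2 (S - S')], so even the constant 2
    would do. *)

Require Import Defs.
From Stdlib Require Import Reals Lra Lia ClassicalEpsilon.
From mathcomp Require all_boot all_order all_algebra complex Rstruct ring.

Module PaulsenDuality.

Import ssreflect ssrfun ssrbool eqtype ssrnat seq fintype bigop choice.
Import order ssralg ssrnum poly matrix mxalgebra mxpoly sesquilinear spectral zmodp.
Import complex Rstruct.
Import ring.
Import Order.TTheory GRing.Theory Num.Theory Num.Def.

Set Implicit Arguments.
Unset Strict Implicit.
Unset Printing Implicit Defensive.

Local Open Scope ring_scope.
Local Open Scope sesquilinear_scope.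

(** * Adjoints and the Hilbert-Schmidt norm *)

Section Matrices.

Variable C : numClosedFieldType.

(* The scalar field is C if [cplx], and the fixed field of conjugation if not. *)
Definition scalars_in (cplx : bool) m n (A : 'M[C]_(m, n)) : Prop :=
  cplx = false -> A ^ conjC = A.

Definition hs2 m n (A : 'M[C]_(m, n)) : C := \tr (A ^t* *m A).

Lemma adjM m n p (A : 'M[C]_(m, n)) (B : 'M[C]_(n, p)) :
  (A *m B) ^t* = B ^t* *m A ^t*.
Proof. by rewrite trmx_mul map_mxM. Qed.

Lemma adjD m n (A B : 'M[C]_(m, n)) : (A + B) ^t* = A ^t* + B ^t*.
Proof. by rewrite linearD map_mxD. Qed.

Lemma adjB m n (A B : 'M[C]_(m, n)) : (A - B) ^t* = A ^t* - B ^t*.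
Proof. by rewrite linearB map_mxB. Qed.

Lemma adj1 n : (1%:M : 'M[C]_n) ^t* = 1%:M.
Proof. by rewrite trmx1 map_mx1. Qed.

Lemma scalars_in_adj cplx m n (A : 'M[C]_(m, n)) :
  scalars_in cplx A -> scalars_in cplx (A ^t*).
Proof.
move=> hA /hA E; have E' : A ^t* = A^T by rewrite -map_trmx E.
by rewrite {1}E'.
Qed.

Lemma scalars_inM cplx m n p (A : 'M[C]_(m, n)) (B : 'M[C]_(n, p)) :
  scalars_in cplx A -> scalars_in cplx B -> scalars_in cplx (A *m B).
Proof. by move=> hA hB h; rewrite map_mxM hA ?hB. Qed.

Lemma scalars_inD cplx m n (A B : 'M[C]_(m, n)) :
  scalars_in cplx A -> scalars_in cplx B -> scalars_in cplx (A + B).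
Proof. by move=> hA hB h; rewrite map_mxD hA ?hB. Qed.

Lemma scalars_inZ cplx m n a (A : 'M[C]_(m, n)) :
  a \is Num.real -> scalars_in cplx A -> scalars_in cplx (a *: A).
Proof.
by move=> /CrealP ha hA h; rewrite map_mxZ hA //; congr (_ *: _); apply: ha.
Qed.

Lemma hs2E m n (A : 'M[C]_(m, n)) : hs2 A = \sum_i \sum_j `|A i j| ^+ 2.
Proof.
rewrite exchange_big /=; apply: eq_bigr => j _; rewrite !mxE.
by apply: eq_bigr => i _; rewrite !mxE normCK mulrC.
Qed.

Lemma diag_mul_adj m n (A : 'M[C]_(m, n)) i :
  (A *m A ^t*) i i = \sum_j `|A i j| ^+ 2.
Proof. by rewrite !mxE; apply: eq_bigr => j _; rewrite !mxE normCK. Qed.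

Lemma diag_adj_mul m n (A : 'M[C]_(m, n)) i :
  (A ^t* *m A) i i = \sum_j `|A j i| ^+ 2.
Proof. by rewrite !mxE; apply: eq_bigr => j _; rewrite !mxE normCK mulrC. Qed.

Lemma diag_mul_adj_ge0 m n (A : 'M[C]_(m, n)) i : 0 <= (A *m A ^t*) i i.
Proof. by rewrite diag_mul_adj sumr_ge0 // => j _; rewrite exprn_ge0. Qed.

Lemma diag_adj_mul_ge0 m n (A : 'M[C]_(m, n)) i : 0 <= (A ^t* *m A) i i.
Proof. by rewrite diag_adj_mul sumr_ge0 // => j _; rewrite exprn_ge0. Qed.

Lemma hs2_ge0 m n (A : 'M[C]_(m, n)) : 0 <= hs2 A.
Proof. by apply: sumr_ge0 => i _; apply: diag_adj_mul_ge0. Qed.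

Lemma hs2_adj m n (A : 'M[C]_(m, n)) : hs2 (A ^t*) = hs2 A.
Proof. by rewrite /hs2 trmxCK mxtrace_mulC. Qed.

Lemma hs2N m n (A : 'M[C]_(m, n)) : hs2 (- A) = hs2 A.
Proof.
have adjN : (- A) ^t* = - A ^t* by rewrite linearN map_mxN.
by rewrite /hs2 adjN mulNmx mulmxN opprK.
Qed.

Lemma hs2D m n (A B : 'M[C]_(m, n)) :
  hs2 (A + B) = hs2 A + hs2 B + (\tr (A ^t* *m B) + \tr (B ^t* *m A)).
Proof. by rewrite /hs2 adjD mulmxDl !mulmxDr !mxtraceD; ring. Qed.

Lemma hs2B m n (A B : 'M[C]_(m, n)) :
  hs2 (A - B) = hs2 A + hs2 B - (\tr (A ^t* *m B) + \tr (B ^t* *m A)).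
Proof. by rewrite /hs2 adjB mulmxBl !mulmxBr !(mxtraceD, raddfN) /=; ring. Qed.

(** * Completing an isometry to a unitary matrix *)

(** The projection [Q] onto the orthogonal complement of the range has trace [N - K > 0], so some
    [Q i i] is nonzero. As [Q* Q = Q], this entry is the squared norm of column [i], which is then
    normalized. A column of [Q] has real entries whenever [T] does. *)
Lemma isometry_new_vector cplx N K (T : 'M[C]_(N, K)) :
  (K < N)%N -> T ^t* *m T = 1%:M -> scalars_in cplx T ->
  exists u : 'cV[C]_N,
    [/\ scalars_in cplx u, u ^t* *m u = 1%:M & T ^t* *m u = 0].
Proof.
move=> ltKN TT hT; pose Q := 1%:M - T *m T ^t*.
have Qadj : Q ^t* = Q by rewrite adjB adj1 adjM trmxCK.
have TQ : T ^t* *m Q = 0 by rewrite mulmxBr mulmx1 mulmxA TT mul1mx subrr.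
have QQ : Q ^t* *m Q = Q.
  by rewrite Qadj {1}/Q mulmxBl mul1mx -mulmxA TQ mulmx0 subr0.
have trQ : \tr Q = (N - K)%:R.
  by rewrite raddfB /= mxtrace_mulC TT !mxtrace1 natrB // ltnW.
have [i Qi] : exists i, Q i i != 0.
  apply/existsP; rewrite -negb_forall; apply/negP => /forallP Q0.
  have: \tr Q = 0 by rewrite /mxtrace big1 // => i _; apply/eqP.
  by move/eqP; rewrite trQ pnatr_eq0 subn_eq0 leqNgt ltKN.
have Qi_gt0 : 0 < Q i i by rewrite lt0r Qi -QQ diag_adj_mul_ge0.
pose c := (sqrtC (Q i i))^-1.
have c_gt0 : 0 < c by rewrite invr_gt0 sqrtC_gt0.
have hc : c^* = c by apply/CrealP/gtr0_real.
exists (c *: col i Q); split.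
- apply: scalars_inZ; first exact: gtr0_real.
  move=> h; rewrite map_col; congr col; rewrite map_mxB map_mx1.
  by congr (_ - _); apply: (scalars_inM hT (scalars_in_adj hT)).
- have -> : (c *: col i Q) ^t* = c *: (col i Q) ^t*.
    by rewrite linearZ /= map_mxZ; congr (_ *: _); apply: hc.
  rewrite -scalemxAl -scalemxAr scalerA; apply/matrixP => a b.
  rewrite !ord1 [LHS]mxE (_ : ((col i Q) ^t* *m col i Q) 0 0 = Q i i); last first.
    by rewrite -{3}QQ !mxE; apply: eq_bigr => j _; rewrite !mxE.
  by rewrite /c -expr2 exprVn sqrtCK mulVf // !mxE.
- by rewrite -scalemxAr colE mulmxA TQ mul0mx scaler0.
Qed.

Lemma isometry_orthogonal_family cplx N K L (T : 'M[C]_(N, K)) :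
  (K + L <= N)%N -> T ^t* *m T = 1%:M -> scalars_in cplx T ->
  exists S : 'M[C]_(N, L),
    [/\ scalars_in cplx S, S ^t* *m S = 1%:M & T ^t* *m S = 0].
Proof.
elim: L K T => [|L IH] K T leN TT hT.
  exists 0; split; first by move=> _; rewrite map_mx0.
    by apply/matrixP => -[].
  by rewrite mulmx0.
have [|u [hu uu Tu]] := isometry_new_vector _ TT hT.
  by apply: leq_trans leN; rewrite addnS ltnS leq_addr.
pose T' := row_mx T u.
have T'adj : T' ^t* = col_mx (T ^t*) (u ^t*) by rewrite tr_row_mx map_col_mx.
have uT : u ^t* *m T = 0.
  by rewrite -[LHS]trmxCK adjM trmxCK Tu trmx0 map_mx0.
have [||| S [hS SS]] := IH (K + 1)%N T'.
- by rewrite -addnA add1n.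
- by rewrite T'adj mul_col_row TT uu Tu uT -scalar_mx_block.
- by move=> h; rewrite map_row_mx hT ?hu.
rewrite T'adj mul_col_mx => /eqP; rewrite col_mx_eq0 => /andP[/eqP TS /eqP uS].
have Su : S ^t* *m u = 0.
  by rewrite -[LHS]trmxCK adjM trmxCK uS trmx0 map_mx0.
exists (row_mx u S); split.
(* Here and below, [L.+1] is restated as the convertible [1 + L], so that the block matrix lemmas
   apply. *)
- move=> h; suff: (row_mx u S) ^ conjC = row_mx u S :> 'M_(N, 1 + L) by [].
  by rewrite map_row_mx hS ?hu.
- suff: (row_mx u S) ^t* *m row_mx u S = 1%:M :> 'M_(1 + L) by [].
  rewrite tr_row_mx map_col_mx mul_col_row uu uS Su SS.
  by rewrite -(scalar_mx_block 1 L).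
- suff: T ^t* *m row_mx u S = 0 :> 'M_(K, 1 + L) by [].
  by rewrite mul_mx_row Tu TS row_mx0.
Qed.

(** The block matrix with columns [T] and [S] is a square isometry, and a left inverse of a square
    matrix is also a right inverse. *)
Lemma orthogonal_isometries_complete N K L (T : 'M[C]_(N, K)) (S : 'M_(N, L)) :
  (K + L = N)%N -> T ^t* *m T = 1%:M -> S ^t* *m S = 1%:M ->
  T ^t* *m S = 0 -> T *m T ^t* + S *m S ^t* = 1%:M.
Proof.
move=> eN; subst N => TT SS TS.
have ST : S ^t* *m T = 0 by rewrite -[LHS]trmxCK adjM trmxCK TS trmx0 map_mx0.
have: (row_mx T S) ^t* *m row_mx T S = 1%:M.
  by rewrite tr_row_mx map_col_mx mul_col_row TT SS TS ST -scalar_mx_block.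
by move/mulmx1C; rewrite tr_row_mx map_col_mx mul_row_col.
Qed.

Lemma isometry_complement cplx N K L (T : 'M[C]_(N, K)) :
  (K + L = N)%N -> T ^t* *m T = 1%:M -> scalars_in cplx T ->
  exists S : 'M[C]_(N, L),
    [/\ scalars_in cplx S, S ^t* *m S = 1%:M & T *m T ^t* + S *m S ^t* = 1%:M].
Proof.
move=> eN TT hT.
have [|S [hS SS TS]] := isometry_orthogonal_family (L := L) _ TT hT.
  by rewrite eN.
by exists S; split=> //; apply: orthogonal_isometries_complete.
Qed.

Lemma hs2_isometry m n p (T : 'M[C]_(m, n)) (A : 'M[C]_(n, p)) :
  T ^t* *m T = 1%:M -> hs2 (T *m A) = hs2 A.
Proof. by move=> TT; rewrite /hs2 adjM -mulmxA (mulmxA (T ^t*)) TT mul1mx. Qed.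

(** * Polar decomposition and the distance between complements *)

(** The [n + 1] distinct numbers [- b / (k + 1)] cannot all be roots of the characteristic
    polynomial, whose degree is [n]. *)
Lemma small_shift_unitmx n (H : 'M[C]_n) b :
  0 < b -> exists2 eta, 0 < eta <= b & H + eta%:M \in unitmx.
Proof.
move=> b_gt0; pose s := [seq - (b / k.+1%:R) | k <- iota 0 n.+1].
have s_uniq : uniq s.
  rewrite map_inj_uniq ?iota_uniq // => k l /oppr_inj /(mulfI (lt0r_neq0 b_gt0)).
  by move/invr_inj/eqP; rewrite eqr_nat eqSS => /eqP.
have /allPn[_ /mapP[k _ ->]] : ~~ all (root (char_poly H)) s.
  apply/negP => /max_poly_roots/(_ s_uniq); rewrite size_char_poly size_map size_iota.
  by rewrite ltnn => /(_ (monic_neq0 (char_poly_monic H))).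
rewrite -eigenvalue_root_char negbK kermx_eq0 row_free_unit raddfN /= opprK.
move=> Hk; exists (b / k.+1%:R) => //.
by rewrite divr_gt0 ?ltr0Sn //= ler_pdivrMr ?ltr0Sn // ler_peMr ?ler1n // ltW.
Qed.

(* Applied to a spectral decomposition and its conjugate, this shows that the
   square root of a real matrix is real. *)
Lemma unitary_diagonalization_fun n (P Q : 'M[C]_n) (d r : 'rV[C]_n) :
  P \is unitarymx -> Q \is unitarymx ->
  (forall i j, d 0 i = d 0 j -> r 0 i = r 0 j) ->
  P ^t* *m diag_mx d *m P = Q ^t* *m diag_mx d *m Q ->
  P ^t* *m diag_mx r *m P = Q ^t* *m diag_mx r *m Q.
Proof.
move=> Pu Qu dr E; pose W := P *m Q ^t*.
have PP : P *m P ^t* = 1%:M by apply/unitarymxP.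
have QQ : Q *m Q ^t* = 1%:M by apply/unitarymxP.
have PP' : P ^t* *m P = 1%:M by apply: mulmx1C.
have QQ' : Q ^t* *m Q = 1%:M by apply: mulmx1C.
have dW : diag_mx d *m W = W *m diag_mx d.
  have := congr1 (fun X => P *m X *m Q ^t*) E.
  by rewrite /W !mulmxA PP mul1mx -!mulmxA QQ mulmx1 !mulmxA.
have rW : diag_mx r *m W = W *m diag_mx r.
  (* Entrywise, [dW] says that [W i j = 0] or [d 0 i = d 0 j]; in both cases [r] may replace [d]. *)
  apply/matrixP => i j; move/matrixP/(_ i j): dW.
  rewrite !mul_diag_mx !mul_mx_diag !mxE mulrC => /eqP.
  rewrite -subr_eq0 -mulrBr mulf_eq0 subr_eq0 => /orP[/eqP->|/eqP/dr->].
    by rewrite mulr0 mul0r.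
  by rewrite mulrC.
have := congr1 (fun X => P ^t* *m X *m Q) rW.
by rewrite /W !mulmxA PP' mul1mx -!mulmxA QQ' mulmx1 !mulmxA.
Qed.

(* [H + eta] is used because the polar part of a singular [H] is not determined
   by [H], and need not be real even if [H] is. *)
Lemma contraction_near_unitary cplx n l (H : 'M[C]_n) (Z : 'M[C]_(l, n)) e :
  H ^t* *m H + Z ^t* *m Z = 1%:M -> scalars_in cplx H -> 0 < e ->
  exists V : 'M[C]_n, [/\ scalars_in cplx V, V ^t* *m V = 1%:M &
    n%:R *+ 2 - (\tr (V ^t* *m H) + \tr (H ^t* *m V)) <= hs2 Z *+ 2 + e].
Proof.
move=> HZ hH e_gt0.
(* The shift will cost at most [8 n eta]; the [+ 1] keeps the denominator positive for [n = 0]. *)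
have [eta /andP[eta_gt0 eta_le] Hu] : exists2 eta,
    0 < eta <= e / (8 * n%:R + 1) & H + eta%:M \in unitmx.
  apply: small_shift_unitmx; rewrite divr_gt0 // ltr_wpDl //.
  by rewrite mulr_ge0 ?ler0n.
have eta_n : 8 * n%:R * eta <= e.
  move: eta_le; rewrite ler_pdivlMr ?ltr_wpDl ?mulr_ge0 ?ler0n //.
  by apply: le_trans; rewrite mulrDr mulr1 mulrC lerDl ltW.
have eta_real : eta^* = eta by apply/CrealP/gtr0_real.
have eta1_gt0 : 0 < 1 + eta by rewrite addr_gt0.
set G := H + eta%:M in Hu; pose A := G ^t* *m G.
have adj_eta : (eta%:M : 'M[C]_n) ^t* = eta%:M.
  by rewrite tr_scalar_mx map_scalar_mx /= eta_real.
have hG : scalars_in cplx G.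
  by apply: scalars_inD => // _; rewrite map_scalar_mx /= eta_real.
have Au : A \in unitmx by rewrite unitmx_mul Hu map_unitmx unitmx_tr Hu.
have AE : A = ((1 + eta) ^+ 2)%:M - (1 + eta) *: (Z ^t* *m Z)
              - eta *: ((H - 1%:M) ^t* *m (H - 1%:M)).
  have -> : Z ^t* *m Z = 1%:M - H ^t* *m H by rewrite -HZ addrC addKr.
  rewrite /A /G adjD adj_eta adjB adj1 !(mulmxDl, mulmxDr, mulmxBl, mulmxBr).
  rewrite !mulNmx !mulmxN !mul1mx !mulmx1 !mul_scalar_mx !mul_mx_scalar.
  rewrite !scalerDr !scalerN -!scale_scalar_mx.
  apply/matrixP => i j; rewrite !mxE; ring.
have Aadj : A ^t* = A by rewrite adjM trmxCK.
have An : A \is normalmx by apply/normalmxP; rewrite Aadj.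
set P := spectralmx A; set d := spectral_diag A.
have Pu : P \is unitarymx by apply: spectral_unitarymx.
have PP : P *m P ^t* = 1%:M by apply/unitarymxP.
have PP' : P ^t* *m P = 1%:M by apply: mulmx1C.
have Ad : A = P ^t* *m diag_mx d *m P.
  by rewrite -(invmx_unitary Pu); apply/orthomx_spectralP.
have dE : diag_mx d = P *m A *m P ^t*.
  by rewrite Ad !mulmxA PP mul1mx -mulmxA PP mulmx1.
have diE i : d 0 i = (P *m A *m P ^t*) i i by rewrite -dE mxE eqxx.
have pos m (X : 'M[C]_(m, n)) i : 0 <= (P *m (X ^t* *m X) *m P ^t*) i i.
  have -> : P *m (X ^t* *m X) *m P ^t* = (P *m X ^t*) *m (P *m X ^t*) ^t*.
    by rewrite adjM trmxCK !mulmxA.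
  exact: diag_mul_adj_ge0.
have d_ge0 i : 0 <= d 0 i.
  by rewrite diE; exact: pos.
have d_le i : d 0 i <= (1 + eta) ^+ 2.
  rewrite diE AE; move: (H - 1%:M) => W; rewrite !mulmxBr !mulmxBl.
  rewrite -!scalemxAr -!scalemxAl mul_mx_scalar.
  rewrite -scalemxAl PP; move: (pos _ Z i) (pos _ W i).
  move: (P *m (Z ^t* *m Z) *m P ^t*) (P *m (_ *m W) *m P ^t*) => X Y Xi Yi.
  rewrite !mxE eqxx mulr1 -addrA gerDl -opprD oppr_le0.
  by rewrite addr_ge0 // mulr_ge0 ?(ltW eta1_gt0) ?(ltW eta_gt0).
pose r := \row_i sqrtC (d 0 i).
have r_ge0 i : 0 <= r 0 i by rewrite mxE sqrtC_ge0.
have rr i : r 0 i ^+ 2 = d 0 i by rewrite mxE sqrtCK.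
have r_le i : r 0 i <= 1 + eta.
  by rewrite -(@ler_pXn2r _ 2) ?nnegrE ?rr ?(ltW eta1_gt0).
(* The positive square root of [A = G* G]. *)
pose B := P ^t* *m diag_mx r *m P.
have Badj : B ^t* = B.
  rewrite /B !adjM trmxCK mulmxA; congr (_ *m _ *m _).
  rewrite tr_diag_mx map_diag_mx; congr diag_mx.
  by apply/rowP => i; rewrite mxE; apply/CrealP/ger0_real.
have BB : B *m B = A.
  rewrite {2}/B !mulmxA /B -[_ *m P *m P^t*]mulmxA PP mulmx1.
  rewrite -[_ *m diag_mx r *m diag_mx r]mulmxA mulmx_diag Ad.
  by congr (_ *m diag_mx _ *m _); apply/rowP => i; rewrite [LHS]mxE -expr2 rr.
(* If [A] is real, conjugating its spectral decomposition gives a second one with the same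
   eigenvalues, hence the same square root. *)
have hB : scalars_in cplx B.
  move=> h; have EA : A ^ conjC = A by apply: scalars_inM h => //; apply: scalars_in_adj.
  have conjd (x : 'rV[C]_n) : (forall i, 0 <= x 0 i) -> diag_mx x ^ conjC = diag_mx x.
    move=> x0; rewrite map_diag_mx; congr diag_mx.
    by apply/rowP => i; rewrite mxE; apply/CrealP/ger0_real.
  have E (x : 'rV[C]_n) : (forall i, 0 <= x 0 i) ->
      (P ^t* *m diag_mx x *m P) ^ conjC
      = (P ^ conjC) ^t* *m diag_mx x *m (P ^ conjC).
    by move=> x0; rewrite !map_mxM conjd // -map_trmx.
  rewrite /B E //; symmetry; apply: (unitary_diagonalization_fun (d := d)) => //.
  - by rewrite conjC_unitary.
  - by move=> i j dij; rewrite !mxE dij.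
  - by rewrite -Ad -E // -Ad EA.
have Bu : B \in unitmx by move: Au; rewrite -BB unitmx_mul andbb.
have iBadj : (invmx B) ^t* = invmx B by rewrite trmx_inv map_invmx Badj.
(* The unitary part of the polar decomposition of [G], for which [V* G = B]. *)
pose V := G *m invmx B.
have Vadj : V ^t* = invmx B *m G ^t* by rewrite adjM iBadj.
have VG : V ^t* *m G = B by rewrite Vadj -mulmxA -/A -BB mulKmx.
have VV : V ^t* *m V = 1%:M by rewrite {2}/V mulmxA VG mulmxV.
exists V; split=> //.
  by apply: scalars_inM => // h; rewrite map_invmx hB.
have trB : \tr B = \sum_i r 0 i by rewrite mxtrace_mulC mulmxA PP mul1mx mxtrace_diag.
have trA : \tr A = \sum_i d 0 i by rewrite Ad mxtrace_mulC mulmxA PP mul1mx mxtrace_diag.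
(* Each eigenvalue of [B] satisfies [r <= 1 + eta], so [r^2 <= (1 + eta) r]. *)
have trAB : 0 <= (1 + eta) * \tr B - \tr A.
  rewrite subr_ge0 trA trB mulr_sumr; apply: ler_sum => i _.
  by rewrite -rr expr2 ler_wpM2r.
have trAE : \tr A = (1 + eta) ^+ 2 * n%:R - (1 + eta) * hs2 Z - eta * hs2 (H - 1%:M).
  have trB2 (X Y : 'M[C]_n) : \tr (X - Y) = \tr X - \tr Y by rewrite raddfB.
  by rewrite AE !trB2 !mxtraceZ mxtrace_scalar mulr_natr.
have hs1 : hs2 (1%:M : 'M[C]_n) = n%:R by rewrite /hs2 adj1 mulmx1 mxtrace1.
have hsH : hs2 H = n%:R - hs2 Z.
  by rewrite -mxtrace1 -HZ mxtraceD addrK.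
(* By the parallelogram law the right side equals [hs2 (H + 1) + 2 hs2 Z]. *)
have hsH1 : 0 <= 4 * n%:R - hs2 (H - 1%:M).
  have := hs2_ge0 (H + 1%:M); rewrite hs2D hs2B hs1 hsH => h1.
  have h2 := hs2_ge0 Z.
  apply: le_trans (addr_ge0 h1 (addr_ge0 h2 h2)) _.
  by rewrite le_eqVlt; apply/orP; left; apply/eqP; ring.
have VH : V ^t* *m H = B - eta *: V ^t*.
  have -> : H = G - eta%:M by rewrite addrK.
  by rewrite mulmxBr VG mul_mx_scalar.
have HV : H ^t* *m V = B - eta *: V.
  have -> : H ^t* *m V = (V ^t* *m H) ^t* by rewrite adjM trmxCK.
  by rewrite VH adjB Badj linearZ /= map_mxZ trmxCK; congr (_ - _ *: _); exact: eta_real.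
have trV : 0 <= n%:R *+ 2 - (\tr (V ^t*) + \tr V).
  have := hs2_ge0 (1%:M - V); rewrite hs2B hs1 adj1 mul1mx mulmx1.
  by rewrite [hs2 V]/hs2 VV mxtrace1 -mulr2n [\tr V + _]addrC.
(* After multiplication by [1 + eta], the difference of the two sides is exactly the sum of the
   nonnegative terms [h3], [h4], [h6] and [h7]. The [8 n eta] in [h3] cancels the [4 n] in the two
   copies of [h5]. *)
rewrite VH HV !raddfB /= !mxtraceZ -subr_ge0 -(pmulr_rge0 _ eta1_gt0).
have h3 : 0 <= e - 8 * n%:R * eta by rewrite subr_ge0.
have h4 := mulr_ge0 (mulr_ge0 (ltW eta1_gt0) (ltW eta_gt0)) trV.
have h5 := mulr_ge0 (ltW eta_gt0) hsH1.
have h6 := mulr_ge0 (ltW eta_gt0) (ltW e_gt0).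
have h7 := addr_ge0 (addr_ge0 h5 h5) (addr_ge0 trAB trAB).
apply: le_trans (addr_ge0 h3 (addr_ge0 h4 (addr_ge0 h6 h7))) _.
by rewrite trAE le_eqVlt; apply/orP; left; apply/eqP; ring.
Qed.

Lemma complement_distance cplx N K L (T : 'M[C]_(N, K)) (S S' : 'M[C]_(N, L)) e :
  (K + L = N)%N -> T ^t* *m T = 1%:M -> T *m T ^t* + S *m S ^t* = 1%:M ->
  S ^t* *m S = 1%:M -> S' ^t* *m S' = 1%:M ->
  scalars_in cplx T -> scalars_in cplx S' -> 0 < e ->
  exists T' : 'M[C]_(N, K), [/\ scalars_in cplx T', T' ^t* *m T' = 1%:M,
    T' *m T' ^t* + S' *m S' ^t* = 1%:M & hs2 (T - T') <= hs2 (S - S') *+ 2 + e].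
Proof.
move=> eN TT TS SS SS' hT hS' e_gt0.
have [T0 [hT0 TT0 ST0]] := isometry_complement (L := K) (etrans (addnC _ _) eN) SS' hS'.
have T_S : T ^t* *m S = 0.
  have := congr1 (fun X => T ^t* *m X *m S) TS.
  rewrite mulmxDr mulmxDl !mulmxA TT mul1mx mulmx1 -[X in _ + X]mulmxA SS mulmx1.
  by move/eqP; rewrite -subr_eq0 addrK => /eqP.
have S_T : S ^t* *m T = 0 by rewrite -[LHS]trmxCK adjM trmxCK T_S trmx0 map_mx0.
(* Since [S* T = 0], only [D = S - S'] contributes, and [T T* = 1 - S S*] gives
   [hs2 (D* T) = hs2 D - hs2 (S* D)]. *)
have hsZ : hs2 (S' ^t* *m T) <= hs2 (S - S').
  have -> : S' ^t* *m T = - ((S - S') ^t* *m T) by rewrite adjB mulmxBl S_T sub0r opprK.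
  have -> (D : 'M[C]_(N, L)) : hs2 (- (D ^t* *m T)) = hs2 D - hs2 (S ^t* *m D).
    rewrite hs2N -hs2_adj adjM trmxCK /hs2 !adjM !trmxCK.
    rewrite mulmxA -[D ^t* *m T *m _]mulmxA (_ : T *m T ^t* = 1%:M - S *m S ^t*).
      by rewrite mulmxBr mulmx1 mulmxBl !mulmxA raddfB.
    by rewrite -TS addrK.
  by rewrite gerDl oppr_le0 hs2_ge0.
have HZ : (T0 ^t* *m T) ^t* *m (T0 ^t* *m T) + (S' ^t* *m T) ^t* *m (S' ^t* *m T) = 1%:M.
  rewrite !adjM !trmxCK -!mulmxA ![_ *m (_ ^t* *m T)]mulmxA -mulmxDr -mulmxDl.
  by rewrite addrC ST0 mul1mx TT.
have hH : scalars_in cplx (T0 ^t* *m T).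
  by apply: scalars_inM => //; apply: scalars_in_adj.
have [V [hV VV Vle]] := contraction_near_unitary HZ hH e_gt0.
exists (T0 *m V); split.
- exact: scalars_inM.
- by rewrite adjM -mulmxA [T0 ^t* *m _]mulmxA TT0 mul1mx.
- by rewrite adjM mulmxA -[T0 *m V *m _]mulmxA (mulmx1C VV) mulmx1 addrC.
rewrite hs2B /hs2 TT adjM -[V ^t* *m _ *m _]mulmxA [T0 ^t* *m (T0 *m V)]mulmxA TT0.
rewrite mul1mx VV !mxtrace1 -mulr2n -[V ^t* *m _ *m T]mulmxA mulmxA addrC.
move: Vle; rewrite adjM trmxCK [X in _ - X <= _]addrC => Vle.
rewrite addrC; apply: le_trans Vle _.
by rewrite lerD2r lerMn2r hsZ.
Qed.

End Matrices.

(** * Existence of equal norm Parseval frames *)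

(** The hypothesis makes the discriminant of this quadratic equation in [t] positive. With [a], [b]
    the squared norms of two rows and [h] their inner product, the solution is the tangent of the
    rotation that gives the first row squared norm [c]. *)
Lemma rotation_parameter (R : rcfType) (a b c h : R) :
  (a - c) * (b - c) < 0 -> exists t, a + 2 * h * t + b * t ^+ 2 = c * (1 + t ^+ 2).
Proof.
move=> abc; have bc : b - c != 0.
  by apply/eqP => bc; move: abc; rewrite bc mulr0 ltxx.
pose q := sqrtr (h ^+ 2 - (a - c) * (b - c)).
have q2 : q ^+ 2 = h ^+ 2 - (a - c) * (b - c).
  by rewrite sqr_sqrtr // subr_ge0 (le_trans (ltW abc)) ?sqr_ge0.
exists ((q - h) / (b - c)); apply/eqP; rewrite -subr_eq0; apply/eqP.
set t := _ / _; have qt : q = t * (b - c) + h by rewrite divfK // subrK.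
apply: (mulfI bc); rewrite mulr0; move: q2; rewrite qt => q2.
have {}q2 : (t * (b - c) + h) ^+ 2 - (h ^+ 2 - (a - c) * (b - c)) = 0.
  by rewrite q2 subrr.
by rewrite -[RHS]q2; ring.
Qed.

(* A plane rotation of the rows [i] and [p], by the angle of tangent [t]. *)
Lemma row_norm_adjust (R : rcfType) N K (T : 'M[R]_(N, K)) (i p : 'I_N) c :
  i != p -> T^T *m T = 1%:M ->
  ((T *m T^T) i i - c) * ((T *m T^T) p p - c) < 0 ->
  exists T' : 'M[R]_(N, K), [/\ T'^T *m T' = 1%:M, (T' *m T'^T) i i = c &
    forall k, k != i -> k != p -> (T' *m T'^T) k k = (T *m T^T) k k].
Proof.
move=> ip TT abc; have [t ht] := rotation_parameter ((T *m T^T) i p) abc.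
have s_gt0 : 0 < 1 + t ^+ 2 by rewrite ltr_pwDl ?sqr_ge0.
pose s := sqrtr (1 + t ^+ 2).
have s2 : s ^+ 2 = 1 + t ^+ 2 by rewrite sqr_sqrtr // ltW.
have s0 : s != 0 by rewrite gt_eqF // sqrtr_gt0.
pose T' : 'M[R]_(N, K) := \matrix_(k, j)
  if k == i then (T i j + t * T p j) / s
  else if k == p then (T p j - t * T i j) / s else T k j.
have T'i j : T' i j = (T i j + t * T p j) / s by rewrite mxE eqxx.
have T'p j : T' p j = (T p j - t * T i j) / s by rewrite mxE eqxx eq_sym (negPf ip).
have T'k k j : k != i -> k != p -> T' k j = T k j.
  by move=> /negPf ki /negPf kp; rewrite mxE ki kp.
exists T'; split.
- rewrite -TT; apply/matrixP => j k; rewrite !mxE.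
  rewrite (bigD1 i) // (bigD1 p) ?[p == i]eq_sym //=.
  rewrite [RHS](bigD1 i) // (bigD1 p) ?[p == i]eq_sym //=.
  rewrite !addrA; congr (_ + _); last first.
    by apply: eq_bigr => l /andP[li lp]; rewrite ![_^T _ _]mxE !T'k.
  rewrite ![_^T _ _]mxE !T'i !T'p.
  have -> : (T i j + t * T p j) / s * ((T i k + t * T p k) / s) +
    (T p j - t * T i j) / s * ((T p k - t * T i k) / s) =
    (T i j * T i k + T p j * T p k) * (1 + t ^+ 2) / s ^+ 2 by field.
  by rewrite -s2 mulfK // expf_neq0.
- have -> : (T' *m T'^T) i i =
      ((T *m T^T) i i + 2 * (T *m T^T) i p * t + (T *m T^T) p p * t ^+ 2) / s ^+ 2.
    rewrite !mxE mulr_sumr !mulr_suml -!big_split /= mulr_suml.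
    by apply: eq_bigr => j _; rewrite ![_^T _ _]mxE T'i; field.
  by rewrite ht -s2 mulfK // expf_neq0.
by move=> k ki kp; rewrite !mxE; apply: eq_bigr => j _; rewrite ![_^T _ _]mxE !T'k.
Qed.

(** Starting from [pid_mx], the rows are corrected one after another, each by a rotation against a
    row whose norm errs in the opposite direction. *)
Lemma equal_norm_isometry (R : rcfType) N K : (K <= N)%N -> (0 < N)%N ->
  exists T : 'M[R]_(N, K),
    T^T *m T = 1%:M /\ forall i, (T *m T^T) i i = K%:R / N%:R.
Proof.
move=> leKN N_gt0; set c := _ / _.
suff /(_ N (leqnn N))[T TT Tc] : forall m, (m <= N)%N ->
    exists2 T : 'M[R]_(N, K), T^T *m T = 1%:M &
    forall i : 'I_N, (i < m)%N -> (T *m T^T) i i = c.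
  by exists T; split=> // i; apply: Tc.
elim=> [_|m IH ltmN].
  exists (pid_mx K) => //.
  by rewrite tr_pid_mx mul_pid_mx minnn (minn_idPr leKN) pid_mx_1.
have [T TT Tc] := IH (ltnW ltmN); pose i := Ordinal ltmN.
have [Ti|Ti] := eqVneq ((T *m T^T) i i) c.
  exists T => // k; rewrite ltnS leq_eqVlt => /orP[/eqP km|]; last exact: Tc.
  by rewrite (_ : k = i) //; apply: val_inj.
(* The deviations sum to zero because the trace is [K]. If no [x p] had the sign opposite to [x i],
   all products [x i * x k] would vanish, including [x i ^ 2]. *)
pose x k := (T *m T^T) k k - c.
have sum_x : \sum_k x i * x k = 0.
  rewrite -mulr_sumr big_split /= sumr_const card_ord.
  have -> : \sum_k (T *m T^T) k k = K%:R by rewrite -[LHS]mxtrace_mulC TT mxtrace1.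
  by rewrite -[(- c) *+ _]mulr_natr mulNr divfK ?subrr ?mulr0 // pnatr_eq0 -lt0n.
have [p xp] : exists p, x i * x p < 0.
  apply/existsP; rewrite -[[exists _, _]]negbK negb_exists; apply/negP => /forallP x_ge0.
  have x_ge k : 0 <= x i * x k by rewrite leNgt.
  have /(_ i isT) := psumr_eq0P (fun k _ => x_ge k) sum_x.
  by move/eqP; rewrite mulf_eq0 orbb subr_eq0 (negPf Ti).
have ip : i != p.
  by apply/eqP => ip; move: xp; rewrite -ip ltNge -expr2 sqr_ge0.
have [T' [TT' Ti' Tk']] := row_norm_adjust ip TT xp.
exists T' => // k; rewrite ltnS leq_eqVlt => /orP[/eqP km|km].
  by rewrite (_ : k = i) //; apply: val_inj.
rewrite Tk' ?Tc //; first by apply/eqP => ki; move: km; rewrite ki ltnn.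
(* Rows already corrected have deviation zero, so [p] is not one of them. *)
by apply/eqP => kp; move: xp; rewrite -kp /x (Tc k km) subrr mulr0 ltxx.
Qed.

(** Polarization: the quadratic form of [D = T* T - 1] vanishes on [e_j + a e_k]. Taking [a = 0] and
    [a = 1] gives [D j j = 0] and [D j k + D k j = 0]. Over the complex field [a = 'i] gives
    [D j k = D k j]; over the real one this is the symmetry of [D]. *)
Lemma isometry_of_hs2 (C : numClosedFieldType) cplx N K (T : 'M[C]_(N, K)) :
  scalars_in cplx T ->
  (forall y : 'cV[C]_K, scalars_in cplx y -> hs2 (T *m y) = hs2 y) ->
  T ^t* *m T = 1%:M.
Proof.
move=> hT Ty; apply/eqP; rewrite -subr_eq0; apply/eqP; set D := _ - _.
have adjD0 : D ^t* = D by rewrite adjB adjM trmxCK adj1.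
have hD : scalars_in cplx D.
  move=> h; rewrite map_mxB map_mx1; congr (_ - _).
  by apply: scalars_inM h => //; apply: scalars_in_adj.
have yDy (y : 'cV[C]_K) : scalars_in cplx y -> (y ^t* *m D *m y) 0 0 = 0.
  move=> hy; have := Ty _ hy; rewrite /hs2 /mxtrace !big_ord1 => E.
  have -> : y ^t* *m D *m y = (T *m y) ^t* *m (T *m y) - y ^t* *m y.
    by rewrite /D mulmxBr mulmx1 mulmxBl adjM !mulmxA.
  move: E; move: ((T *m y) ^t* *m (T *m y)) (y ^t* *m y) => X Y E.
    by rewrite !mxE E subrr.
clearbody D.
have D_ex j k a : (cplx = false -> a^* = a) ->
    D j j + a * D j k + a^* * D k j + a^* * a * D k k = 0.
  move=> ha; pose y : 'cV[C]_K := delta_mx j 0 + a *: delta_mx k 0.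
  have hdelta l : (delta_mx l 0 : 'cV[C]_K) ^ conjC = delta_mx l 0.
    by rewrite map_delta_mx.
  have y_adj : y ^t* = delta_mx 0 j + a^* *: delta_mx 0 k.
    by rewrite /y linearD linearZ /= map_mxD map_mxZ !trmx_delta !map_delta_mx.
  have /yDy : scalars_in cplx y.
    by move=> h; rewrite map_mxD map_mxZ /= !hdelta; congr (_ + _ *: _); apply: ha.
  have De (l m : 'I_K) : (delta_mx 0 l *m D *m delta_mx m 0 : 'M[C]_1) 0 0 = D l m.
    by rewrite -rowE -colE !mxE.
  rewrite y_adj /y !(mulmxDl, mulmxDr) -!(scalemxAl, scalemxAr).
  have AE (A B : 'M[C]_1) : (A + B) 0 0 = A 0 0 + B 0 0 by rewrite mxE.
  have ZE b (A : 'M[C]_1) : (b *: A) 0 0 = b * A 0 0 by rewrite mxE.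
  rewrite !(AE, ZE, De) => E; rewrite -[RHS]E; ring.
have Djj j : D j j = 0.
  by have := D_ex j j 0 (fun _ => conjC0 _); rewrite conjC0 !mul0r !addr0.
apply/matrixP => j k; rewrite [RHS]mxE.
have D1 : D j k + D k j = 0.
  have := D_ex j k 1 (fun _ => conjC1 _).
  by rewrite conjC1 !mul1r !Djj add0r addr0.
have two0 : (2 : C) != 0 by rewrite pnatr_eq0.
apply: (mulfI two0); rewrite mulr0; case: cplx hD D_ex {hT Ty yDy} => [_|hD _].
  have hi : true = false -> 'i^* = 'i :> C by [].
  move/(_ j k 'i hi).
  rewrite conjCi !Djj mulr0 add0r addr0 mulNr -mulrBr => /eqP.
  rewrite mulf_eq0 (negPf (neq0Ci _)) subr_eq0 => /eqP E.
  by rewrite -D1 -E; ring.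
have Dkj : D k j = D j k by rewrite -{1}adjD0 -{2}(hD erefl) !mxE.
by rewrite -D1 Dkj; ring.
Qed.

(** * Translation between frames and matrices *)

Section Frames.
Local Open Scope complex_scope.

Local Notation C := R[i].

Definition frame_mx K N (F : Defs.family) : 'M[C]_(N, K) :=
  \matrix_(i, j) (fst (F i j) +i* snd (F i j)).

(** The default zero outside the matrix is what [in_space] requires of coordinates beyond [K]. *)
Definition mx_frame K N (T : 'M[C]_(N, K)) : Defs.family := fun i j =>
  match insub i, insub j with
  | Some i', Some j' => (complex.Re (T i' j'), complex.Im (T i' j'))
  | _, _ => (R0, R0)
  end.

Lemma sumRE n f : sumR n f = \sum_(i < n) f i.
Proof. by elim: n => [|n IH]; rewrite ?big_ord0 // big_ord_recr /= IH. Qed.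

Lemma mx_frameK K N (T : 'M[C]_(N, K)) : frame_mx K N (mx_frame T) = T.
Proof. by apply/matrixP => i j; rewrite mxE /mx_frame !valK /=; case: (T i j). Qed.

Lemma conjC_complex (a b : R) : conjC (a +i* b : C) = a -i* b.
Proof. by []. Qed.

Lemma mx_frame_in cplx K N (T : 'M[C]_(N, K)) :
  scalars_in cplx T -> family_in cplx K N (mx_frame T).
Proof.
move=> hT i _ j; rewrite /mx_frame; split=> [/ssrnat.leP leKj|h].
  by case: insub => // i'; rewrite insubF // ltnNge leKj.
case: insub => // i'; case: insub => // j' /=.
move/matrixP/(_ i' j'): (hT h); rewrite mxE; case: (T i' j') => a b [] /eqP.
by rewrite eq_sym -addr_eq0 -mulr2n mulrn_eq0 /= => /eqP.
Qed.

Lemma frame_mx_scalars cplx K N F :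
  family_in cplx K N F -> scalars_in cplx (frame_mx K N F).
Proof.
move=> hF h; apply/matrixP => i j; rewrite !mxE conjC_complex.
have /ssrnat.ltP ltiN := ltn_ord i.
by rewrite (proj2 (hF i ltiN j) h) oppr0.
Qed.

Lemma norm_complex (a b : R) : `|a +i* b : C| ^+ 2 = (a ^+ 2 + b ^+ 2)%:C.
Proof. by rewrite -add_Re2_Im2. Qed.

Lemma norm2E K N (F : Defs.family) (i : 'I_N) :
  (norm2 K (F i))%:C = (frame_mx K N F *m (frame_mx K N F) ^t*) i i.
Proof.
rewrite diag_mul_adj /norm2 sumRE rmorph_sum; apply: eq_bigr => j _.
by rewrite mxE norm_complex !RpowE.
Qed.

Lemma frame_distE K N F G :
  (frame_dist K N F G)%:C = hs2 (frame_mx K N F - frame_mx K N G).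
Proof.
rewrite hs2E /frame_dist sumRE rmorph_sum; apply: eq_bigr => i _.
rewrite /norm2 sumRE rmorph_sum; apply: eq_bigr => j _.
by rewrite !mxE !RpowE; exact: esym (norm_complex _ _).
Qed.

Lemma sum_complex n (a b : 'I_n -> R) :
  \sum_i (a i +i* b i) = (\sum_i a i) +i* (\sum_i b i) :> C.
Proof. by elim/big_rec3: _ => // i x y z _ ->. Qed.

Lemma inner_abs2E K N f (F : Defs.family) (i : 'I_N) :
  (inner_abs2 K f (F i))%:C =
  `|(frame_mx K N F *m \col_(j < K) (fst (f j) -i* snd (f j))) i 0| ^+ 2.
Proof.
suff -> : (frame_mx K N F *m \col_(j < K) (fst (f j) -i* snd (f j))) i 0 =
    inner_re K f (F i) -i* inner_im K f (F i).
  by rewrite norm_complex sqrrN /inner_abs2 !RpowE.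
rewrite mxE /inner_re /inner_im !sumRE -sumrN -sum_complex; apply: eq_bigr => j _.
rewrite !mxE; apply/eqP; rewrite eq_complex /= !(RplusE, RminusE, RmultE).
by apply/andP; split; apply/eqP; ring.
Qed.

(* [inner_abs2] conjugates the frame vectors while [frame_mx] does not, hence the
   conjugate of [f] on the right. *)
Lemma parseval_hs2 K N F f :
  (sumR N (fun i => inner_abs2 K f (F i)))%:C =
  hs2 (frame_mx K N F *m \col_(j < K) (fst (f j) -i* snd (f j))).
Proof.
rewrite hs2E sumRE rmorph_sum; apply: eq_bigr => i _.
by rewrite big_ord1; exact: inner_abs2E.
Qed.

Lemma norm2_hs2 K f :
  (norm2 K f)%:C = hs2 (\col_(j < K) (fst (f j) -i* snd (f j)) : 'cV[C]_K).
Proof.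
rewrite hs2E /norm2 sumRE rmorph_sum; apply: eq_bigr => i _.
by rewrite big_ord1 mxE norm_complex sqrrN !RpowE.
Qed.

Lemma isometry_parseval cplx K N F :
  (frame_mx K N F) ^t* *m frame_mx K N F = 1%:M -> parseval cplx K N F.
Proof.
move=> TT f _; apply: complexI; rewrite parseval_hs2 norm2_hs2.
exact: hs2_isometry.
Qed.

Lemma parseval_isometry cplx K N F : family_in cplx K N F ->
  parseval cplx K N F -> (frame_mx K N F) ^t* *m frame_mx K N F = 1%:M.
Proof.
move=> hF pF; apply: (isometry_of_hs2 (frame_mx_scalars hF)) => y hy.
(* The conjugate of [y], to compensate for the conjugation in [parseval_hs2]. *)
pose f : cvec := fun j =>
  if insub j is Some j' then (complex.Re (y j' 0), - complex.Im (y j' 0)) else (R0, R0).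
have fy : \col_(j < K) (fst (f j) -i* snd (f j)) = y.
  apply/colP => j; rewrite mxE /f valK /= opprK; by case: (y j 0).
rewrite -fy -parseval_hs2 -norm2_hs2 pF // => j; split.
  by move=> /ssrnat.leP leKj; rewrite /f insubF // ltnNge leKj.
move=> h; rewrite /f; case: insub => // j' /=.
move/matrixP/(_ j' 0): (hy h); rewrite mxE; case: (y j' 0) => a b [] /eqP.
rewrite eq_sym -addr_eq0 -mulr2n mulrn_eq0 /= => /eqP ->.
by rewrite oppr0.
Qed.

(** A real matrix serves both fields. This makes the sets behind [dist_to_ENP] and [paulsen]
    nonempty. *)
Lemma equal_norm_parseval_exists cplx K N :
  (K <= N)%coq_nat -> (0 < N)%coq_nat ->
  exists G, [/\ family_in cplx K N G, parseval cplx K N G &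
    forall i, (i < N)%coq_nat -> norm2 K (G i) = Rdiv (INR K) (INR N)].
Proof.
move=> /ssrnat.leP leKN /ssrnat.ltP N_gt0.
have [T [TT Tn]] := equal_norm_isometry R leKN N_gt0.
pose f := @real_complex R; pose Tc := map_mx f T.
have Tadj : Tc ^t* = map_mx f T^T.
  by apply/matrixP => i j; rewrite !mxE; apply: conjc_real.
exists (mx_frame Tc); split.
- apply: mx_frame_in => _.
  by apply/matrixP => i j; rewrite !mxE; apply: conjc_real.
- by apply: isometry_parseval; rewrite mx_frameK Tadj -map_mxM TT map_mx1.
move=> l /ssrnat.ltP ltlN; apply: complexI.
rewrite -[l]/(val (Ordinal ltlN)) norm2E mx_frameK Tadj -map_mxM mxE Tn.
by rewrite RdivE !INRE.
Qed.

Lemma complementary_norms K L N F G :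
  frame_mx K N F *m (frame_mx K N F) ^t* +
  frame_mx L N G *m (frame_mx L N G) ^t* = 1%:M ->
  forall i, (i < N)%coq_nat -> Rplus (norm2 K (F i)) (norm2 L (G i)) = R1.
Proof.
move=> FG l /ssrnat.ltP ltlN; apply: complexI.
transitivity ((norm2 K (F l))%:C + (norm2 L (G l))%:C); first exact: rmorphD.
rewrite (norm2E K F (Ordinal ltlN)) (norm2E L G (Ordinal ltlN)).
have := congr1 (fun X : 'M[C]_N => X (Ordinal ltlN) (Ordinal ltlN)) FG.
move: (_ *m _) (_ *m _) => X Y; by rewrite !mxE eqxx.
Qed.

(** One complement [G] must serve every [G'], because [G'] will be chosen close to [G]. The slack
    [e] is inherited from the perturbed polar decomposition. *)
Lemma naimark_complement cplx K L N F : (K + L)%N = N ->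
  family_in cplx K N F -> parseval cplx K N F ->
  exists G, [/\ family_in cplx L N G, parseval cplx L N G,
    forall i, (i < N)%coq_nat -> Rplus (norm2 K (F i)) (norm2 L (G i)) = R1 &
    forall G' e, family_in cplx L N G' -> parseval cplx L N G' -> Rlt 0 e ->
    exists F', [/\ family_in cplx K N F', parseval cplx K N F',
      forall i, (i < N)%coq_nat -> Rplus (norm2 K (F' i)) (norm2 L (G' i)) = R1 &
      Rle (frame_dist K N F F') (Rplus (Rmult 2 (frame_dist L N G G')) e)]].
Proof.
move=> eN hF pF; have TT := parseval_isometry hF pF.
have hT := frame_mx_scalars hF.
have [S [hS SS TS]] := isometry_complement eN TT hT.
exists (mx_frame S); split.
- exact: mx_frame_in.
- by apply: isometry_parseval; rewrite mx_frameK.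
- by apply: complementary_norms; rewrite mx_frameK.
move=> G' e hG' pG' /RltP e_gt0; have e_gt0C : 0 < e%:C :> C by rewrite ltcR.
have [T' [hT' TT' TS' dT']] := complement_distance eN TT TS SS
  (parseval_isometry hG' pG') hT (frame_mx_scalars hG') e_gt0C.
exists (mx_frame T'); split.
- exact: mx_frame_in.
- by apply: isometry_parseval; rewrite mx_frameK.
- by apply: complementary_norms; rewrite mx_frameK.
apply/RleP; rewrite -lecR frame_distE mx_frameK RplusE RmultE rmorphD rmorphM /=.
rewrite frame_distE mx_frameK (_ : (IZR 2)%:C = 2%:R) ?mulr_natl //.
by rewrite (IZRposE 2) INRE rmorph_nat.
Qed.

End Frames.

End PaulsenDuality.

(** * Suprema, infima and the Paulsen function *)

Lemma supR_lub (S : R -> Prop) (b : R) :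
  (exists x, S x) -> (forall x, S x -> x <= b) -> is_lub S (supR S).
Proof.
  intros hne hb; unfold supR; apply epsilon_spec.
  destruct (completeness S) as [x hx]; [now exists b | assumption | now exists x].
Qed.

Lemma infR_glb (S : R -> Prop) :
  (exists x, S x) -> (forall x, S x -> 0 <= x) ->
  0 <= infR S /\ (forall x, S x -> infR S <= x) /\
  (forall e, 0 < e -> exists x, S x /\ x < infR S + e).
Proof.
  intros [x0 hx0] hpos.
  assert (hlub : is_lub (fun x => S (- x)) (supR (fun x => S (- x)))).
  { apply supR_lub with 0.
    - exists (- x0); now rewrite Ropp_involutive.
    - intros x hx; apply hpos in hx; lra. }
  unfold infR; set (s := supR _) in *; destruct hlub as [hub hleast].
  split; [|split].
  - enough (s <= 0) by lra.
    apply hleast; intros x hx; apply hpos in hx; lra.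
  - intros x hx; enough (- x <= s) by lra.
    apply hub; now rewrite Ropp_involutive.
  - intros e he; apply NNPP; intros hno.
    enough (s <= s - e) by lra.
    apply hleast; intros x hx; apply Rnot_lt_le; intros hlt.
    apply hno; exists (- x); split; [assumption | lra].
Qed.

Lemma sumR_nonneg (n : nat) (f : nat -> R) :
  (forall i, (i < n)%nat -> 0 <= f i) -> 0 <= sumR n f.
Proof.
  induction n as [|n IH]; intros hf; simpl; [lra|].
  apply Rplus_le_le_0_compat; [apply IH; intros i hi |]; apply hf; lia.
Qed.

Lemma sumR_le (n : nat) (f g : nat -> R) :
  (forall i, (i < n)%nat -> f i <= g i) -> sumR n f <= sumR n g.
Proof.
  induction n as [|n IH]; intros hf; simpl; [lra|].
  apply Rplus_le_compat; [apply IH; intros i hi |]; apply hf; lia.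
Qed.

Lemma norm2_nonneg (K : nat) (f : cvec) : 0 <= norm2 K f.
Proof. apply sumR_nonneg; intros; nra. Qed.

Lemma frame_dist_nonneg (K N : nat) (F G : Defs.family) : 0 <= frame_dist K N F G.
Proof. apply sumR_nonneg; intros; apply norm2_nonneg. Qed.

(** The parallelogram law with [f + g] dropped; it bounds the distances whose supremum is taken. *)
Lemma norm2_vsub_le (K : nat) (f g : cvec) :
  norm2 K (vsub f g) <= 2 * norm2 K f + 2 * norm2 K g.
Proof.
  unfold norm2; induction K as [|K IH]; simpl; [lra|].
  simpl in IH; pose proof (Rle_0_sqr (fst (f K) + fst (g K))).
  pose proof (Rle_0_sqr (snd (f K) + snd (g K))); unfold Rsqr in *; lra.
Qed.

Definition equal_norm_parseval (cplx : bool) (K N : nat) (G : Defs.family) : Prop :=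
  family_in cplx K N G /\ equal_norm K N G /\ parseval cplx K N G.

Definition nearly_equal_norm_parseval (cplx : bool) (delta : R) (K N : nat)
    (F : Defs.family) : Prop :=
  family_in cplx K N F /\ nearly_equal_norm delta K N F /\ parseval cplx K N F.

Section Paulsen.

Variables (cplx : bool) (K N : nat).
Hypotheses (leKN : (K <= N)%nat) (N_pos : (0 < N)%nat).

Lemma dist_to_ENP_spec (F : Defs.family) :
  0 <= dist_to_ENP cplx K N F /\
  (forall G, equal_norm_parseval cplx K N G ->
     dist_to_ENP cplx K N F <= frame_dist K N F G) /\
  (forall e, 0 < e -> exists G, equal_norm_parseval cplx K N G /\
     frame_dist K N F G < dist_to_ENP cplx K N F + e).
Proof.
  destruct (infR_glb (fun d => exists G, family_in cplx K N G /\ equal_norm K N G /\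
              parseval cplx K N G /\ d = frame_dist K N F G)) as [h0 [hle hlt]].
  - destruct (PaulsenDuality.equal_norm_parseval_exists cplx leKN N_pos)
      as [G [hG pG nG]].
    exists (frame_dist K N F G), G; split; [assumption | split; [|now split]].
    intros i j hi hj; now rewrite !nG.
  - intros x [G [_ [_ [_ ->]]]]; apply frame_dist_nonneg.
  - fold (dist_to_ENP cplx K N F) in *; split; [assumption | split].
    + intros G [hG [eG pG]]; apply hle; now exists G.
    + intros e he; destruct (hlt e he) as [x [[G [hG [eG [pG ->]]]] hx]].
      now exists G.
Qed.

Lemma paulsen_lub (delta : R) : 0 <= delta ->
  is_lub (fun x => exists F, nearly_equal_norm_parseval cplx delta K N F /\
                             x = dist_to_ENP cplx K N F)
         (paulsen cplx delta K N).
Proof.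
  intros hdelta.
  destruct (PaulsenDuality.equal_norm_parseval_exists cplx leKN N_pos)
    as [G [hG pG nG]].
  assert (eG : equal_norm K N G) by (intros i j hi hj; now rewrite !nG).
  assert (hKN : 0 <= INR K / INR N).
  { apply Rmult_le_pos; [apply pos_INR | left; apply Rinv_0_lt_compat, lt_0_INR; lia]. }
  assert (hlub : is_lub (fun x => exists F, family_in cplx K N F /\
      nearly_equal_norm delta K N F /\ parseval cplx K N F /\
      x = dist_to_ENP cplx K N F) (paulsen cplx delta K N)).
  (* Every distance to the equal norm frames is at most the distance to the fixed [G]. The set is
     nonempty because [G] itself is nearly equal norm, as [delta >= 0]. *)
  { apply supR_lub with
      (sumR N (fun i => 2 * ((1 + delta) * (INR K / INR N)) + 2 * (INR K / INR N))).
    - exists (dist_to_ENP cplx K N G), G; split; [assumption | split; [|now split]].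
      intros i hi; rewrite (nG i hi); nra.
    - intros x [F [hF [nF [pF ->]]]].
      apply Rle_trans with (frame_dist K N F G).
      + apply dist_to_ENP_spec; split; auto.
      + apply sumR_le; intros i hi.
        pose proof (norm2_vsub_le K (F i) (G i)) as hv; rewrite (nG i hi) in hv.
        pose proof (nF i hi); lra. }
  destruct hlub as [hub hleast]; split.
  - intros x [F [[hF [nF pF]] ->]]; apply hub; now exists F.
  - intros b hb; apply hleast; intros x [F [hF [nF [pF ->]]]].
    apply hb; exists F; split; [now split | reflexivity].
Qed.

End Paulsen.

(** * Comparison of the two Paulsen functions *)

Theorem theorem6p1 (cplx : bool) (M N : nat) (eps : R) :
  (1 <= M)%nat -> (M < N)%nat -> 0 < eps ->
  paulsen cplx eps M N <=
  8 * paulsen cplx (eps * (INR M / INR (N - M))) (N - M) N.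
Proof.
  intros hM hMN heps.
  assert (leMN : (M <= N)%nat) by lia.
  assert (leLN : (N - M <= N)%nat) by lia.
  assert (N_pos : (0 < N)%nat) by lia.
  assert (eN : (M + (N - M))%nat = N) by lia.
  assert (M_pos : 0 < INR M) by (apply lt_0_INR; lia).
  assert (N_posR : 0 < INR N) by (apply lt_0_INR; lia).
  assert (L_pos : 0 < INR (N - M)) by (apply lt_0_INR; lia).
  assert (eNR : INR N = INR M + INR (N - M)) by (rewrite <- plus_INR, eN; reflexivity).
  assert (hdelta : 0 <= eps * (INR M / INR (N - M))).
  { left; apply Rmult_lt_0_compat; [assumption | now apply Rdiv_lt_0_compat]. }
  apply (paulsen_lub cplx M N leMN N_pos _ (Rlt_le _ _ heps)).
  intros x [F [[hF [nF pF]] ->]].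
  destruct (PaulsenDuality.naimark_complement eN hF pF) as [G [hG pG nFG hdual]].
  assert (nG : nearly_equal_norm (eps * (INR M / INR (N - M))) (N - M) N G).
  { intros i hi; specialize (nF i hi); specialize (nFG i hi).
    set (L := INR (N - M)) in *.
    (* The norms of [G] are [1] minus those of [F], so the lower bound for one is the upper bound
       for the other; [N = M + L] matches the constants. *)
    replace ((1 - eps * (INR M / L)) * (L / INR N))
      with (1 - (1 + eps) * (INR M / INR N)) by (rewrite eNR; field; lra).
    replace ((1 + eps * (INR M / L)) * (L / INR N))
      with (1 - (1 - eps) * (INR M / INR N)) by (rewrite eNR; field; lra).
    lra. }
  assert (hdG : dist_to_ENP cplx (N - M) N G <=
                paulsen cplx (eps * (INR M / INR (N - M))) (N - M) N).
  { apply (paulsen_lub cplx (N - M) N leLN N_pos _ hdelta); exists G.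
    split; [now split | reflexivity]. }
  destruct (dist_to_ENP_spec cplx (N - M) N leLN N_pos G) as [hdG0 [_ hdGapprox]].
  apply le_epsilon; intros e he.
  (* The error of [G'] is doubled by the duality, which adds its own [e / 3]: the total is [e]. *)
  destruct (hdGapprox (e / 3)) as [G' [[hG' [eG' pG']] hGG']]; [lra|].
  destruct (hdual G' (e / 3) hG' pG') as [F' [hF' pF' nFG' hFF']]; [lra|].
  apply Rle_trans with (frame_dist M N F F').
  - apply (dist_to_ENP_spec cplx M N leMN N_pos F); split; [assumption | split; [|assumption]].
    intros i j hi hj; pose proof (nFG' i hi); pose proof (nFG' j hj).
    pose proof (eG' i j hi hj); lra.
  (* The bound obtained is [2 * dist_to_ENP] of [G] plus [e]; [hdG0] and [hdG] allow the passage
     from 2 to 8. *)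
  - lra.
Qed.
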